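(* Let $0\le\ell\le n$ and let $K_n^{(\ell)}$ be the complete graph on vertex set $\{1,\dots,n\}$ in which the vertices $1,\dots,n-\ell$ are distinguished. Then $$P_{n,\ell}(s,t)=\sum_{E}2^{c(E)}\,\mathrm{wt}(E),$$ where the sum runs over all elementary subgraphs $E$ of $K_n^{(\ell)}$, $c(E)$ is the number of components of $E$ that are cycles (of length $\ge3$), $d(E)$ is the number of distinguished vertices that are isolated in $E$, and $\mathrm{wt}(E)=(s+t)^{d(E)}t^{\,n-d(E)}$.
   Context: $P_{n,\ell}(s,t)$ is the permanent of the $n\times n$ matrix whose first $n-\ell$ diagonal entries equal $s+t$ and all of whose other entries equal $t$. An elementary subgraph of a graph $G$ is a spanning subgraph of $G$ each of whose connected components is an isolated vertex, a single edge, or a cycle of length at least $3$. *)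

(* Defs.v *)
From mathcomp Require Import all_boot all_order all_algebra.
From mathcomp Require Import all_fingroup.

Set Implicit Arguments.
Unset Strict Implicit.
Unset Printing Implicit Defensive.

Import GRing.Theory.

Local Open Scope ring_scope.

Definition permanent (R : comNzRingType) (n : nat) (A : 'M[R]_n) : R :=
  \sum_(s : 'S_n) \prod_i A i (s i).

(* The vertices 1, ..., n are represented by the ordinals 0, ..., n - 1. *)
Definition distinguished (n l : nat) : {set 'I_n} := [set i : 'I_n | (i < n - l)%N].

Definition Pmx (R : comNzRingType) (n l : nat) (s t : R) : 'M[R]_n :=
  \matrix_(i, j) (if (i == j) && (i \in distinguished n l) then s + t else t).

Definition P (R : comNzRingType) (n l : nat) (s t : R) : R :=
  permanent (Pmx n l s t).

Local Open Scope nat_scope.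

Section Graphs.
Variable T : finType.

(* A simple graph with vertex set T is given by its set of edges, each edge
   being a set of two vertices; so a spanning subgraph of G is a subset of G. *)
Implicit Types (G E F : {set {set T}}) (C : {set T}).

Definition complete_graph : {set {set T}} := [set e : {set T} | #|e| == 2].

Definition adjacent E : rel T := [rel x y | [set x; y] \in E].

(* The vertex sets of the connected components. *)
Definition components E : {set {set T}} :=
  equivalence_partition (connect (adjacent E)) [set: T].

Definition edges_in E C : {set {set T}} := [set e in E | e \subset C].

Definition isolated E (x : T) : bool := [forall e in E, x \notin e].

(* The next three predicates are about the graph with vertex set C and
   edge set F. *)
Definition is_single_vertex C F : bool := (#|C| == 1) && (F == set0).

Definition is_single_edge C F : bool := (#|C| == 2) && (F == [set C]).

(* The vertices can be listed without repetition as c, in such a way that the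
   edges join each vertex to its cyclic successor in c. *)
Definition is_cycle C F : bool :=
  (3 <= #|C|) &&
  [exists c : #|C|.-tuple T,
     [&& uniq c, [set x in c] == C & F == [set [set x; next c x] | x in c]]].

Definition elementary_subgraph G E : bool :=
  (E \subset G) &&
  [forall C in components E,
     [|| is_single_vertex C (edges_in E C),
         is_single_edge C (edges_in E C)
       | is_cycle C (edges_in E C)]].

Definition num_cycles E : nat :=
  #|[set C in components E | is_cycle C (edges_in E C)]|.

End Graphs.

Definition num_isolated (n l : nat) (E : {set {set 'I_n}}) : nat :=
  #|[set i in distinguished n l | isolated E i]|.

Local Open Scope ring_scope.

Definition wt (R : comNzRingType) (n l : nat) (s t : R) (E : {set {set 'I_n}}) : R :=
  (s + t) ^+ num_isolated l E * t ^+ (n - num_isolated l E).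

(* Main.v *)
(* Send a permutation u to the graph with edges {x, u x}, x not fixed by u. Its
   components are the orbits of u, so it is elementary, its isolated vertices
   are the fixed points, and the term of u in the permanent is the weight of the
   graph. Every elementary graph arises, and if it comes from s then it comes
   exactly from the permutations obtained by reversing s on some of the orbits
   of size at least 3, which are 2 ^ (number of cycles) many. *)
Require Import Defs.
From mathcomp Require Import all_boot all_order all_algebra.
From mathcomp Require Import all_fingroup.

Import GRing.Theory.

Set Implicit Arguments.
Unset Strict Implicit.
Unset Printing Implicit Defensive.

Local Open Scope ring_scope.

(** * The graph of a permutation: adjacency, components, isolated vertices *)

Definition cycle_graph (T : finType) (s : {perm T}) : {set {set T}} :=
  [set [set x; s x] | x in [set x | s x != x]].

Lemma set2_eq (T : finType) (x y u v : T) :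
  [set x; y] = [set u; v] -> x = u /\ y = v \/ x = v /\ y = u.
Proof.
move=> E.
have : x \in [set u; v] by rewrite -E set21.
have : y \in [set u; v] by rewrite -E set22.
have : u \in [set x; y] by rewrite E set21.
have : v \in [set x; y] by rewrite E set22.
by rewrite !inE; do ![case/orP => /eqP ?]; subst; tauto.
Qed.

Lemma adjacent_cycle_graph (T : finType) (s : {perm T}) (x y : T) :
  adjacent (cycle_graph s) x y = (x != y) && ((y == s x) || (x == s y)).
Proof.
apply/imsetP/andP => [[z] | [xy /orP[] /eqP e]].
- rewrite inE => zs /set2_eq[] [-> ->].
  + by rewrite eqxx eq_sym.
  + by rewrite eqxx orbT.
- by exists x; rewrite ?inE -?e // eq_sym.
- by exists y; rewrite ?inE -?e // setUC.
Qed.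

Lemma adjacent_sym (T : finType) (E : {set {set T}}) : symmetric (adjacent E).
Proof. by move=> x y; rewrite /adjacent /= setUC. Qed.

Lemma connect_adjacent_equiv (T : finType) (E : {set {set T}}) :
  {in [set: T] & &, equivalence_rel (connect (adjacent E))}.
Proof.
move=> x y z _ _ _; split=> [|xy]; first exact: connect0.
exact: (same_connect (sym_connect_sym (@adjacent_sym _ E)) xy).
Qed.

Lemma components_partition (T : finType) (E : {set {set T}}) :
  partition (components E) [set: T].
Proof. by apply/equivalence_partitionP/connect_adjacent_equiv. Qed.

Lemma mem_pblock_components (T : finType) (E : {set {set T}}) (x y : T) :
  (y \in pblock (components E) x) = connect (adjacent E) x y.
Proof.
by apply: pblock_equivalence_partition; rewrite ?inE //;
  apply: connect_adjacent_equiv.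
Qed.

(** The orbit consists of forward iterates of [x], so closure under [s] alone suffices. This serves
    as the induction principle for orbits. *)
Lemma porbit_sub_closed (T : finType) (s : {perm T}) (A : {set T}) (x : T) :
  {in A, forall y, s y \in A} -> x \in A -> porbit s x \subset A.
Proof.
move=> sA xA; apply/subsetP => y /porbitP[i ->].
by rewrite permX; elim: i => //= i /sA.
Qed.

Lemma perm_mem_porbit (T : finType) (s : {perm T}) (x : T) :
  s x \in porbit s x.
Proof. by have := mem_porbit s 1 x; rewrite expg1. Qed.

Lemma porbit_permS (T : finType) (s : {perm T}) (x : T) :
  porbit s (s x) = porbit s x.
Proof. by apply/eqP; rewrite eq_porbit_mem perm_mem_porbit. Qed.

Lemma porbit_permV (T : finType) (s : {perm T}) (x : T) :
  porbit s ((s^-1)%g x) = porbit s x.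
Proof. by rewrite -[in RHS](permKV s x) porbit_permS. Qed.

Lemma connect_cycle_graph (T : finType) (s : {perm T}) (x y : T) :
  connect (adjacent (cycle_graph s)) x y = (y \in porbit s x).
Proof.
apply/idP/idP => [/connectP[p + ->] | ].
  elim: p x => [|z p IHp] x; first by move=> _; apply: porbit_id.
  move=> /andP[]; rewrite adjacent_cycle_graph => /andP[_ xz] /IHp.
  by case/orP: xz => /eqP->; rewrite porbit_permS.
have/subsetP : porbit s x \subset [set z | connect (adjacent (cycle_graph s)) x z].
  apply: porbit_sub_closed; last by rewrite inE connect0.
  move=> z; rewrite !inE => /connect_trans-> //.
  have [-> | sz] := eqVneq (s z) z; first exact: connect0.
  by apply: connect1; rewrite adjacent_cycle_graph eq_sym sz eqxx.
by move=> sub /sub; rewrite inE.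
Qed.

Lemma components_cycle_graph (T : finType) (s : {perm T}) :
  components (cycle_graph s) = porbits s.
Proof.
have block x : [set y in [set: T] | connect (adjacent (cycle_graph s)) x y]
             = porbit s x.
  by apply/setP => y; rewrite !inE connect_cycle_graph.
by apply/setP => C; apply/imsetP/imsetP => -[x _ ->];
  exists x; rewrite ?inE ?block.
Qed.

Lemma isolated_cycle_graph (T : finType) (s : {perm T}) (x : T) :
  isolated (cycle_graph s) x = (s x == x).
Proof.
apply/forall_inP/eqP => [iso | sx _ /imsetP[z + ->]].
  apply/eqP; apply: contraT => sx.
  by have := iso [set x; s x]; rewrite set21; apply; apply: imset_f; rewrite inE.
rewrite !inE; apply: contra => /orP[] /eqP e; first by rewrite -e sx.
by apply/eqP/(@perm_inj _ s); rewrite -e sx.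
Qed.

Lemma edges_in_cycle_graph (T : finType) (s : {perm T}) (x : T) :
  edges_in (cycle_graph s) (porbit s x) =
  [set [set y; s y] | y in porbit s x & s y != y].
Proof.
apply/setP => e; rewrite inE; apply/andP/imsetP.
- case=> /imsetP[y]; rewrite inE => sy -> /subsetP/(_ y (set21 _ _)) yx.
  by exists y; rewrite ?inE ?yx.
- case=> y; rewrite inE => /andP[yx sy] ->.
  split; first by apply: imset_f; rewrite inE.
  rewrite subUset !sub1set yx /= porbit_sym porbit_permS.
  by rewrite porbit_sym.
Qed.

(** * Orbit sizes, and why the graph of a permutation is elementary *)

(** If [s (s x) = x], the pair [[set x; s x]] is closed under [s] and contains the orbit; otherwise
    [x], [s x] and [s (s x)] are three distinct points of it. *)
Lemma card_porbit_gt2 (T : finType) (s : {perm T}) (x : T) :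
  (2 < #|porbit s x|)%N = (s (s x) != x).
Proof.
apply/idP/idP => [|ssx].
  apply: contraL => /eqP ssx; rewrite -leqNgt.
  apply: (@leq_trans #|[set x; s x]|); last by rewrite cards2; case: (_ != _).
  apply/subset_leq_card/porbit_sub_closed; last exact: set21.
  by move=> y /set2P[] ->; rewrite ?ssx ?set21 ?set22.
have sx : s x != x by apply: contraNneq ssx => sx; rewrite !sx.
have u : uniq [:: x; s x; s (s x)].

  by rewrite /= !inE !negb_or (inj_eq perm_inj) ![x == _]eq_sym sx ssx.
suff /subset_leq_card : [:: x; s x; s (s x)] \subset porbit s x by rewrite (card_uniqP u).
apply/subsetP => y.
by rewrite !inE => /or3P[] /eqP->; rewrite ?porbit_id // porbit_sym ?porbit_permS porbit_id.
Qed.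

Lemma card_porbit_gt1 (T : finType) (s : {perm T}) (x : T) :
  (1 < #|porbit s x|)%N = (s x != x).
Proof.
apply/idP/idP => [|sx].
  apply: contraL => /eqP sx; rewrite -leqNgt -(cards1 x).
  apply/subset_leq_card/porbit_sub_closed; last exact: set11.
  by move=> y /set1P ->; rewrite sx set11.
have u : uniq [:: x; s x] by rewrite /= inE eq_sym sx.
suff /subset_leq_card : [:: x; s x] \subset porbit s x by rewrite (card_uniqP u).
apply/subsetP => y.
by rewrite !inE => /orP[] /eqP->; rewrite ?porbit_id // porbit_sym ?porbit_permS porbit_id.
Qed.

(** Hence [next] along this listing of the orbit is [s], which yields the listing demanded by
    [is_cycle]. *)
Lemma fcycle_traject_porbit (T : finType) (s : {perm T}) (x : T) :
  fcycle s (traject s x #|porbit s x|).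
Proof.
have : iter #|porbit s x| s x = x := iter_porbit s x.
case: #|porbit s x| => // m; rewrite iterSr /= => smx.
by rewrite -[X in rcons _ X]smx -trajectSr fpath_traject.
Qed.

Lemma is_cycle_porbit (T : finType) (s : {perm T}) (x : T) :
  is_cycle (porbit s x) (edges_in (cycle_graph s) (porbit s x)) =
  (2 < #|porbit s x|)%N.
Proof.
rewrite /is_cycle; have [gt2 /= | //] := boolP (2 < _)%N.
apply/existsP; exists (Tuple (introT eqP (size_traject s x #|porbit s x|))) => /=.
rewrite uniq_traject_porbit /=; apply/andP; split.
  by apply/eqP/setP => y; rewrite inE porbit_traject.
apply/eqP; rewrite edges_in_cycle_graph; apply/setP => e.
have nextE y : y \in porbit s x -> next (traject s x #|porbit s x|) y = s y.
  rewrite porbit_traject => yx.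
  by apply/esym/eqP/(next_cycle (fcycle_traject_porbit s x)).
apply/imsetP/imsetP => -[y yx ->]; exists y.
- by rewrite -porbit_traject; move: yx; rewrite inE => /andP[].
- by rewrite nextE //; move: yx; rewrite inE => /andP[].
(* An orbit with more than two points has no fixed point, so the filter [s y != y] removes
   nothing. *)
- move: yx; rewrite -porbit_traject inE => yx; rewrite yx -card_porbit_gt1.
  by move: yx; rewrite -eq_porbit_mem => /eqP->; apply: ltnW.
- by rewrite nextE // porbit_traject.
Qed.

Lemma elementary_cycle_graph (T : finType) (s : {perm T}) :
  elementary_subgraph (complete_graph T) (cycle_graph s).
Proof.
apply/andP; split.
  apply/subsetP => _ /imsetP[x + ->].
  by rewrite !inE cards2 eq_sym => ->.
rewrite components_cycle_graph; apply/forall_inP => _ /imsetP[x _ ->].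
rewrite is_cycle_porbit /is_single_vertex /is_single_edge edges_in_cycle_graph.
have [//|le2] := boolP (2 < _)%N; first by rewrite !orbT.
rewrite orbF.
(* An orbit of size at most 2 is [[set x; s x]]: a single vertex if [x] is fixed, a single edge
   otherwise. *)
have ssx : s (s x) = x by move: le2; rewrite card_porbit_gt2 negbK => /eqP.
have xE : porbit s x = [set x; s x].
  apply/eqP; rewrite eqEsubset subUset !sub1set porbit_id perm_mem_porbit !andbT.
  apply: porbit_sub_closed; last exact: set21.
  by move=> y /set2P[] ->; rewrite ?ssx ?set21 ?set22.
have [sx|sx] := eqVneq (s x) x.
  rewrite xE sx setUid cards1 /= orbF; apply/eqP/setP => e; rewrite inE.
  by apply/negP => /imsetP[y]; rewrite !inE => /andP[/eqP->]; rewrite sx eqxx.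
rewrite xE cards2 [x == _]eq_sym sx /=; apply/eqP/setP => e; rewrite inE.
apply/imsetP/eqP => [[y] | ->]; last by exists x; rewrite // !inE eqxx sx.
by rewrite !inE => /andP[/orP[] /eqP-> _] ->; rewrite ?ssx // setUC.
Qed.

(** * Every elementary graph is the graph of a permutation *)

(* Each of the three kinds of components is traversed by a cyclic listing [c],
   possibly of length 1 or 2. *)
Lemma elementary_component_listing (T : finType) (E : {set {set T}}) (C : {set T}) :
  elementary_subgraph (complete_graph T) E -> C \in components E ->
  exists c : seq T, [/\ uniq c, [set x in c] = C &
    edges_in E C = [set [set x; next c x] | x in C & next c x != x]].
Proof.
case/andP=> _ /forall_inP/[apply] /or3P[].
- case/andP=> /cards1P[x ->] /eqP->; exists [:: x]; split=> //.
    by apply/setP => y; rewrite !inE.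
  apply/setP => e; rewrite inE; apply/esym/negP => /imsetP[y].
  by rewrite !inE => /andP[/eqP->] /=; rewrite !eqxx.
- case/andP=> /cards2P[x [y [xy ->]]] /eqP->; exists [:: x; y]; split=> //=.
  + by rewrite inE xy.
  + by apply/setP => z; rewrite !inE.
  apply/setP => e; rewrite inE; apply/eqP/imsetP => [-> | [z]].
    by exists x; rewrite ?inE /= ?eqxx //= eq_sym.
  rewrite !inE => /andP[/orP[] /eqP-> _] ->; rewrite eqxx //.
  by rewrite eq_sym (negPf xy) setUC.
- case/andP=> gt2 /existsP[c /and3P[uc /eqP cC /eqP->]]; exists c; split=> //.
  have memc z : (z \in C) = (z \in c) by move/setP/(_ z): cC; rewrite inE.
  apply/setP => e; apply/imsetP/imsetP => -[x xc ->]; exists x => //.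
    rewrite inE memc xc /=.
    (* With [x] rotated to the front, its successor is the second entry, which differs from [x] by
       uniqueness. *)
    have : (1 < size c)%N by rewrite size_tuple; apply: ltnW.
    case/rot_to: xc => i [|y p] rotc; first by rewrite -(size_rot i) rotc.
    have -> : next c x = y by rewrite -(next_rot i uc) rotc /= eqxx.
    by move: uc; rewrite -(rot_uniq i) rotc /= inE negb_or eq_sym => /andP[/andP[]].
  by move: xc; rewrite inE memc => /andP[].
Qed.

(** The permutation sends each vertex to its successor in the listing of its component. It preserves
    components, and [prev] inverts it on each of them. *)
Lemma elementary_is_cycle_graph (T : finType) (E : {set {set T}}) :
  elementary_subgraph (complete_graph T) E -> exists s, cycle_graph s = E.
Proof.
move=> elE; have listing := elementary_component_listing elE.
have /and3P[/eqP covE trivE _] := components_partition E.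
have inblock x : x \in pblock (components E) x by rewrite mem_pblock covE.
have block x : pblock (components E) x \in components E.
  by rewrite pblock_mem ?covE.
(* One listing is fixed per component; other sets get the empty list as a dummy value. *)
have/fin_all_exists[c cP] : forall C : {set T}, exists c, C \in components E ->
    [/\ uniq c, [set x in c] = C &
    edges_in E C = [set [set x; next c x] | x in C & next c x != x]].
  move=> C; have [/listing[c cP] | _] := boolP (C \in components E).
    by exists c.
  by exists [::].
pose h x := next (c (pblock (components E) x)) x.
have h_block x : pblock (components E) (h x) = pblock (components E) x.
  apply: (same_pblock trivE).
  have [_ /setP cC _] := cP _ (block x).
  have memc y : (y \in pblock (components E) x) = (y \in c (pblock (components E) x)).
    by rewrite -cC inE.
  by rewrite memc mem_next -memc.
have h_inj : injective h.
  move=> x y hxy; have Bxy : pblock (components E) x = pblock (components E) y.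
    by rewrite -h_block hxy h_block.
  have [uc _ _] := cP _ (block y).
  by apply: (can_inj (prev_next uc)); rewrite -{1}Bxy.
exists (perm h_inj); apply/setP => e; apply/imsetP/idP => [[x] | eE].
  rewrite inE permE => hx ->.
  have [_ _ Ex] := cP _ (block x).
  have : [set x; h x] \in edges_in E (pblock (components E) x).
    by rewrite Ex; apply/imsetP; exists x; rewrite // inE inblock.
  by rewrite inE => /andP[].
have /cards2P[a [b [ab eab]]] : #|e| == 2.
  by case/andP: elE => /subsetP/(_ e eE); rewrite inE.
have adj_ab : adjacent E a b by rewrite /adjacent /= -eab.
(* The ends of [e] are connected, so [e] lies inside the component of [a] and is one of the edges of
   its listing. *)
have [_ _ /setP/(_ e)] := cP _ (block a).
rewrite inE eE eab subUset !sub1set inblock mem_pblock_components connect1 //=.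
case/esym/imsetP => x; rewrite inE => /andP[xa].
rewrite -(same_pblock trivE xa) => hx ->.
by exists x; rewrite ?inE permE.
Qed.

(** * Permutations with the same graph: reversal on orbits *)

(** The orientations are encoded by the set of reversed orbits, so that counting them means counting
    a powerset. *)
Definition reverse_fun (T : finType) (s : {perm T}) (S : {set {set T}}) (x : T) : T :=
  if porbit s x \in S then (s^-1)%g x else s x.

Lemma reverse_fun_inj (T : finType) (s : {perm T}) (S : {set {set T}}) :
  injective (reverse_fun s S).
Proof.
have orbE x : porbit s (reverse_fun s S x) = porbit s x.
  by rewrite /reverse_fun; case: ifP; rewrite ?porbit_permV ?porbit_permS.
move=> x y xy; have := xy; rewrite /reverse_fun -orbE xy orbE.
by case: ifP => _ /perm_inj.
Qed.

Definition reverse_on (T : finType) (s : {perm T}) (S : {set {set T}}) : {perm T} :=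
  perm (@reverse_fun_inj T s S).

Lemma reverse_onE (T : finType) (s : {perm T}) (S : {set {set T}}) (x : T) :
  reverse_on s S x = if porbit s x \in S then (s^-1)%g x else s x.
Proof. exact: permE. Qed.

Lemma cycle_graph_reverse_on (T : finType) (s : {perm T}) (S : {set {set T}}) :
  cycle_graph (reverse_on s S) = cycle_graph s.
Proof.
apply/setP => e; apply/imsetP/imsetP => -[x]; rewrite inE.
  rewrite reverse_onE; case: ifP => _ sx ->; last by exists x; rewrite ?inE.
  exists ((s^-1)%g x); last by rewrite permKV setUC.
  by rewrite inE permKV eq_sym.
move=> sx ->; have [xS|xS] := boolP (porbit s x \in S).
  by exists (s x); rewrite ?inE reverse_onE porbit_permS xS permK ?[x == _]eq_sym // setUC.
by exists x; rewrite ?inE reverse_onE (negPf xS).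
Qed.

(** The only possible neighbours of [x] in the graph of [s] are its image and its preimage; fixed
    points are handled by isolation. *)
Lemma cycle_graph_neighbor (T : finType) (s u : {perm T}) (x : T) :
  cycle_graph u = cycle_graph s -> u x = s x \/ s (u x) = x.
Proof.
move=> us; have [ux|ux] := eqVneq (u x) x.
  left; rewrite ux; apply/esym/eqP.
  by rewrite -isolated_cycle_graph -us isolated_cycle_graph ux.
have : adjacent (cycle_graph u) x (u x).
  by rewrite adjacent_cycle_graph eq_sym ux eqxx.
by rewrite us adjacent_cycle_graph => /andP[_ /orP[] /eqP]; auto.
Qed.

(* If [u] agrees with [s] at [x] but goes back from [s x] to [x], then [x] and
   [s x] form a two-cycle of [u], hence also of [s]. *)
Lemma cycle_graph_agree_next (T : finType) (s u : {perm T}) (x : T) :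
  cycle_graph u = cycle_graph s -> u x = s x -> u (s x) = s (s x).
Proof.
move=> us uxs; have [// | sus] := cycle_graph_neighbor (s x) us.
have ux : u (s x) = x by apply: (@perm_inj _ s).
have [<- // | ] := cycle_graph_neighbor (s x) (esym us).
by rewrite -[in RHS]uxs => /perm_inj; rewrite ux.
Qed.

Lemma cycle_graph_agree_porbit (T : finType) (s u : {perm T}) (x y : T) :
  cycle_graph u = cycle_graph s -> y \in porbit s x -> u x = s x -> u y = s y.
Proof.
move=> us yx uxs; apply/eqP.
suff /subsetP/(_ y yx) : porbit s x \subset [set z | u z == s z] by rewrite inE.
apply: porbit_sub_closed; last by rewrite inE uxs.
by move=> z; rewrite !inE => /eqP/(cycle_graph_agree_next us)->.
Qed.

(** On an orbit of size at least 3, [s] and its inverse differ at every point, so a single value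
    reveals whether the orbit was reversed. *)
Lemma reverse_on_inj (T : finType) (s : {perm T}) :
  {in powerset [set C in porbits s | (2 < #|C|)%N] &, injective (reverse_on s)}.
Proof.
move=> S1 S2; rewrite !powersetE => /subsetP S1sub /subsetP S2sub S12.
apply/setP => C.
have [/setIdP[/imsetP[x _ ->]]|CC] :=
    boolP (C \in [set C in porbits s | (2 < #|C|)%N]); last first.
  by rewrite (contraNF (S1sub C) CC) (contraNF (S2sub C) CC).
rewrite card_porbit_gt2 => ssx; have sVx : (s^-1)%g x <> s x.
  by move/(congr1 s); rewrite permKV => xss; rewrite -xss eqxx in ssx.
have := congr1 (fun u : {perm T} => u x) S12.
by rewrite !reverse_onE; do 2!case: ifP => _ //; move/esym.
Qed.

Lemma cycle_graph_fiber (T : finType) (s : {perm T}) :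
  [set u | cycle_graph u == cycle_graph s] =
  reverse_on s @: powerset [set C in porbits s | (2 < #|C|)%N].
Proof.
apply/setP => u; rewrite inE; apply/eqP/imsetP => [us | [S _ ->]]; last first.
  exact: cycle_graph_reverse_on.
(* Agreement with [s] at one point spreads over the orbit, so one disagreement forces [u] to be the
   inverse of [s] on the whole orbit. *)
exists [set C in porbits s | (2 < #|C|)%N & [exists x in C, u x != s x]].
  by rewrite powersetE; apply/subsetP => C; rewrite !inE => /and3P[-> ->].
apply/permP => x; rewrite reverse_onE inE card_porbit_gt2 imset_f //=.
have revx : u x != s x -> u x = (s^-1)%g x.
  by case: (cycle_graph_neighbor x us) => [->|sux _]; rewrite ?eqxx // -[in RHS]sux permK.
case: ifP => [/andP[_ /exists_inP[y yx uy]] | ].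
  apply: revx; apply: contraNneq uy => ux; apply/eqP.
  exact: cycle_graph_agree_porbit us yx ux.
(* A disagreement at [x] would select its orbit unless the orbit has at most two points, where [s]
   equals its inverse. *)
have [//|ux] := eqVneq (u x) (s x); move/negbT; rewrite negb_and negbK => /orP[/eqP ssx|].
  by rewrite revx // -[in LHS]ssx permK.
by case/negP; apply/exists_inP; exists x; rewrite ?porbit_id.
Qed.

Lemma num_cycles_cycle_graph (T : finType) (s : {perm T}) :
  num_cycles (cycle_graph s) = #|[set C in porbits s | (2 < #|C|)%N]|.
Proof.
rewrite /num_cycles components_cycle_graph; apply: eq_card => C; rewrite !inE.
apply: andb_id2l => /imsetP[x _ ->]; exact: is_cycle_porbit.
Qed.

Lemma card_cycle_graph_fiber (T : finType) (E : {set {set T}}) :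
  elementary_subgraph (complete_graph T) E ->
  #|[set u | cycle_graph u == E]| = (2 ^ num_cycles E)%N.
Proof.
case/elementary_is_cycle_graph => s <-.
rewrite cycle_graph_fiber (card_in_imset (@reverse_on_inj _ s)).
by rewrite card_powerset num_cycles_cycle_graph.
Qed.

(** * Weights and the final summation *)

(** The entry [s + t] is met exactly at the distinguished fixed points of [u], which are the
    distinguished isolated vertices of its graph. *)
Lemma prod_Pmx (R : comNzRingType) (n l : nat) (s t : R) (u : 'S_n) :
  \prod_i Pmx n l s t i (u i) = wt l s t (cycle_graph u).
Proof.
rewrite /wt; set d := num_isolated _ _.
have dE : d = #|[pred i | (i == u i) && (i \in distinguished n l)]|.
  by apply: eq_card => i; rewrite !inE isolated_cycle_graph andbC eq_sym.
have dC : (n - d)%N = #|[predC [pred i | (i == u i) && (i \in distinguished n l)]]|.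
  by rewrite -[X in (X - _)%N](card_ord n) -(cardC [pred i | (i == u i) && (i \in distinguished n l)]) -dE addKn.
rewrite dC dE -!prodr_const (bigID [pred i | (i == u i) && (i \in distinguished n l)]) /=.
by congr (_ * _); apply: eq_bigr => i; rewrite mxE => ?; [rewrite ifT | rewrite ifN].
Qed.

Unset Implicit Arguments.

Theorem theorem5p5 (R : comNzRingType) (n l : nat) (s t : R) (hl : (l <= n)%N) :
  P n l s t =
  \sum_(E : {set {set 'I_n}} | elementary_subgraph (complete_graph 'I_n) E)
     2%:R ^+ num_cycles E * wt l s t E.
Proof.
rewrite /P /permanent; under eq_bigr => u _ do rewrite prod_Pmx.
(* Permutations are grouped by their graph; the weight is constant on each group, whose size is the
   power of 2. *)
rewrite (partition_big (@cycle_graph _)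
  (elementary_subgraph (complete_graph 'I_n))) /=; last first.
  by move=> u _; apply: elementary_cycle_graph.
apply: eq_bigr => E elE.
transitivity (\sum_(u in [set u : 'S_n | cycle_graph u == E]) wt l s t E).
  by apply: eq_big => u; [rewrite inE | move/eqP->].
by rewrite sumr_const (card_cycle_graph_fiber elE) -[LHS]mulr_natl natrX.
Qed.
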